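(* Suppose (i) $G$ is a continuous distribution on $[0,\bar v]$ with density bounded below by some constant $L>0$, and (ii) for every $\lambda>0$, the set $\{v\in(0,\bar v]: r(v)/c(v)\ne\lambda\}$ has positive probability under $F$. If $\mathbb E_{v\sim F,p\sim G}[p\mathbf 1[v\ge p]]>\rho$, then \[\mathbb E_{\bm v,\bm p}\big[R^{\mathrm{pac}}(\bm v,\bm p)\big]-\mathbb E_{\bm v,\bm p,\bm\gamma}\big[R^{\mathrm{thr}}(\bm v,\bm p,\bm\gamma)\big]=\Theta(T).\]
   Context: Model: constants $\bar v>0$, $\rho\in(0,\bar v]$; $T$ rounds; budget $B=\rho T$. Values $v_t$ i.i.d. from $F$ on $[0,\bar v]$; highest competing bids $p_t$ i.i.d. from $G$ on $[0,\bar v]$, independent of values, unknown to the buyer. $r(v)=\mathbb E_{p\sim G}[(v-p)^+]$, $c(v)=\mathbb E_{p\sim G}[p\mathbf 1[v\ge p]]$. Throttling: each round the buyer chooses $x_t\in\{0,1\}$ after seeing $v_t$, receiving $x_t(v_t-p_t)^+$ and paying $x_tp_t\mathbf 1[v_t\ge p_t]$; an online throttling strategy sets $x_t=\beta_t(\mathcal H_t,v_t,\gamma_t)$ with internal randomness $\gamma_t$ and history of past values, decisions and observed competing bids (full information: all past $p_\tau$; partial information: $p_\tau$ only when $x_\tau=1$), keeping total payment within $B$; revenue $\sum_{t=1}^{T_0}x_t(v_t-p_t)^+$. $R^{\mathrm{thr}}$ is the revenue of the throttling strategy maximizing expected total revenue (expectation over $\bm v,\bm p,\bm\gamma$), under full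 or partial information. Pacing: $R^{\mathrm{pac}}$ is the revenue of the adaptive pacing strategy of Balseiro and Gur (2019): with step size $\varepsilon$ of order $T^{-1/2}$, multiplier cap $\bar\mu\ge\bar v/\rho$, initial $\mu_1\in[0,\bar\mu]$ and $\tilde B_1=B$, in each round it bids $b_t=\min\{v_t/(1+\mu_t),\tilde B_t\}$ in the second-price auction (winning iff $b_t\ge p_t$, then paying $p_t$ and gaining $v_t-p_t$), observes its expenditure $z_t=p_t\mathbf 1[b_t\ge p_t]$, and updates $\mu_{t+1}=\mathrm{Proj}_{[0,\bar\mu]}(\mu_t-\varepsilon(\rho-z_t))$, $\tilde B_{t+1}=\tilde B_t-z_t$. *)

(* Defs.v *)
From HB Require Import structures.
From mathcomp Require Import all_boot all_order all_algebra.
From mathcomp Require Import all_classical all_reals all_analysis.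
Set Implicit Arguments. Unset Strict Implicit. Unset Printing Implicit Defensive.
Import Order.TTheory GRing.Theory Num.Theory.
Import numFieldNormedType.Exports.
Local Open Scope classical_set_scope.
Local Open Scope ring_scope.

Section Model.
Variable R : realType.

Definition rfun (G : {measure set R -> \bar R}) (v : R) : R :=
  Rintegral G setT (fun p => Num.max (v - p) 0).
Definition cfun (G : {measure set R -> \bar R}) (v : R) : R :=
  Rintegral G setT (fun p => if p <= v then p else 0).

(* Expectation over T i.i.d. rounds (v_t,p_t), v_t ~ F, p_t ~ G, written as
   the iterated integral; the head of the list is round 1. *)
Fixpoint iidE2 (F G : {measure set R -> \bar R}) (n : nat)
    (f : seq (R * R) -> R) : R :=
  match n with
  | 0 => f [::]
  | n'.+1 => Rintegral F setT (fun v => Rintegral G setT (fun p =>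
               iidE2 F G n' (fun s => f ((v, p) :: s))))
  end.

Fixpoint iidE3 (F G : {measure set R -> \bar R}) (n : nat)
    (f : seq (R * R * R) -> R) : R :=
  match n with
  | 0 => f [::]
  | n'.+1 => Rintegral F setT (fun v => Rintegral G setT (fun p =>
               Rintegral (@lebesgue_measure R) `[0%R, 1%R] (fun g =>
                 iidE3 F G n' (fun s => f ((v, p, g) :: s)))))
  end.

(* Admissibility: every integrand occurring in the iterated expectation
   iidE3 is measurable, so that the expectation is a genuine one. *)
Fixpoint iidE3_measurable (F G : {measure set R -> \bar R}) (n : nat)
    (f : seq (R * R * R) -> R) : Prop :=
  match n with
  | 0 => True
  | n'.+1 =>
      measurable_fun setT (fun v => Rintegral G setT (fun p =>
               Rintegral (@lebesgue_measure R) `[0%R, 1%R] (fun g =>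
                 iidE3 F G n' (fun s => f ((v, p, g) :: s))))) /\
      (forall v, measurable_fun setT (fun p =>
               Rintegral (@lebesgue_measure R) `[0%R, 1%R] (fun g =>
                 iidE3 F G n' (fun s => f ((v, p, g) :: s))))) /\
      (forall v p, measurable_fun setT (fun g =>
                 iidE3 F G n' (fun s => f ((v, p, g) :: s)))) /\
      (forall v p g, iidE3_measurable F G n' (fun s => f ((v, p, g) :: s)))
  end.

Definition proj_int (a b x : R) : R := Num.min (Num.max x a) b.

Fixpoint pac_rev (rho eps mubar : R) (mu Bt : R) (s : seq (R * R)) : R :=
  match s with
  | [::] => 0
  | (v, p) :: s' =>
      let b := Num.min (v / (1 + mu)) Bt in
      let win := p <= b in
      let z := if win then p else 0 in
      (if win then v - p else 0) +
      pac_rev rho eps mubar (proj_int 0 mubar (mu - eps * (rho - z))) (Bt - z) s'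
  end.

Definition pacE (F G : {measure set R -> \bar R}) (rho eps mubar mu1 : R)
    (T : nat) : R :=
  iidE2 F G T (pac_rev rho eps mubar mu1 (rho * T%:R)).

(* history entry of a past round: (v_tau, x_tau, observed p_tau) *)
Definition hist := seq (R * bool * option R).
(* strategy: x_t = beta (H_t) v_t gamma_t *)
Definition strategy := hist -> R -> R -> bool.

(* Revenue of a throttling strategy: rounds are counted up to T_0, the last
   round at which the cumulative payment is still within the budget B. *)
Fixpoint thr_rev (full : bool) (beta : strategy) (B : R) (H : hist)
    (spent : R) (s : seq (R * R * R)) : R :=
  match s with
  | [::] => 0
  | (v, p, g) :: s' =>
      let x := beta H v g in
      let pay := if x && (p <= v) then p else 0 in
      let obs := if full || x then Some p else None in
      if spent + pay <= B then
        (if x then Num.max (v - p) 0 else 0) +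
        thr_rev full beta B (rcons H (v, x, obs)) (spent + pay) s'
      else 0
  end.

Definition thr_revT (full : bool) (beta : strategy) (rho : R) (T : nat) :=
  thr_rev full beta (rho * T%:R) [::] 0.

Definition thrOpt (full : bool) (F G : {measure set R -> \bar R}) (rho : R)
    (T : nat) : R :=
  sup [set iidE3 F G T (thr_revT full beta rho T) | beta in
        [set beta : strategy | iidE3_measurable F G T (thr_revT full beta rho T)]].

End Model.

(* Main.v *)
(* Write r, c for the mean value and mean cost of participating at value v.  By
   Lagrangian relaxation of the budget, throttling earns per round at most
     Dthr(lam) = E_v[(r(v) - lam c(v))^+] + lam rho            (any lam >= 0),
   whereas bidding v / (1 + mu) wins exactly when v - p >= mu p, so that the
   pacing multiplier runs online gradient descent on
     D(mu) = E_{v,p}[(v - (1 + mu) p)^+] + mu rho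
   and pacing earns per round at least inf D, up to O(T^(-1/2)).
   Jensen's inequality gives Dthr <= D.  It is strict for mu > 0, because
   v - (1 + mu) p changes sign on 0 <= p <= v and the density charges both
   sides; near mu = 0, E[c] > rho makes Dthr(lam) < Dthr(0) <= D(0) for a small
   lam.  Hence some Dthr(lam) lies strictly below inf D. *)
Require Import Defs.
From HB Require Import structures.
From mathcomp Require Import all_boot all_order all_algebra.
From mathcomp Require Import all_classical all_reals all_analysis.
From mathcomp Require Import measurable_realfun ring lra.
Import Order.TTheory GRing.Theory Num.Theory.
Import numFieldNormedType.Exports.
Local Open Scope classical_set_scope.
Local Open Scope ring_scope.
Set Implicit Arguments.
Unset Strict Implicit.
Unset Printing Implicit Defensive.

(** * Means against a measure of total mass one *)

Section Mean.
Context d (T : measurableType d) (R : realType).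
Variables (mu : {measure set T -> \bar R}) (E D : set T).

(* [E] is the domain of integration and [D] the part of it that carries the mass. *)
Definition unit_mass : Prop :=
  [/\ measurable E, measurable D, D `<=` E, mu (E `\` D) = 0%E & mu E = 1%E].

(** Measurability is asked on all of [E] but the bound only on [D]: revenues are uncontrolled at
    values or prices outside [[0, vbar]], which form a null set. *)
Definition bdd_meas (f : T -> R) : Prop :=
  measurable_fun E f /\ exists C, forall x, D x -> `|f x| <= C.

Hypothesis um : unit_mass.
Implicit Types (f g : T -> R) (a b c : R).

Lemma bdd_meas_integrable f : bdd_meas f -> mu.-integrable E (EFin \o f).
Proof.
case: um => mE mD DE ED0 E1 [mf [C fC]].
apply: (negligible_integrable (measurableD mE mD) mE _ ED0).2.
  exact/measurable_EFinP.
have -> : E `\` (E `\` D) = D by rewrite setDD setIidr.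
apply: measurable_bounded_integrable => //.
- by rewrite (@le_lt_trans _ _ 1%E) ?ltry// -E1; apply: le_measure; rewrite ?inE.
- exact: measurable_funS mf.
- exists C; split; first exact: num_real.
  by move=> M CM x /fC /le_trans; apply; exact: ltW.
Qed.

Lemma Rintegral_mass f : bdd_meas f -> Rintegral mu E f = Rintegral mu D f.
Proof.
move=> bf; case: (um) => mE mD DE ED0 E1.
rewrite /Rintegral (negligible_integral (measurableD mE mD) mE _ ED0).
  by rewrite setDD setIidr.
exact: bdd_meas_integrable.
Qed.

Lemma mean_le f g : bdd_meas f -> bdd_meas g ->
  (forall x, D x -> f x <= g x) -> Rintegral mu E f <= Rintegral mu E g.
Proof.
move=> bf bg fg; rewrite !Rintegral_mass//; case: (um) => mE mD DE _ _.
by apply: le_Rintegral => //; apply: (integrableS mE) => //;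
  exact: bdd_meas_integrable.
Qed.

Lemma mean_cst c : Rintegral mu E (fun=> c) = c.
Proof. by case: um => mE _ _ _ E1; rewrite Rintegral_cst// E1/= mulr1. Qed.

Lemma bdd_meas_cst c : bdd_meas (fun=> c).
Proof. by split; [exact: measurable_cst | exists `|c|]. Qed.

Lemma bdd_meas_between f a b : measurable_fun E f ->
  (forall x, D x -> a <= f x <= b) -> bdd_meas f.
Proof.
move=> mf ab; split=> //; exists (`|a| + `|b|) => x /ab /andP[af fb].
rewrite ler_norml; have := ler_norm b; have := ler_norm (- a); rewrite normrN.
have := normr_ge0 a; have := normr_ge0 b => ? ? ? ?; apply/andP; split; lra.
Qed.

Lemma bdd_measD f g : bdd_meas f -> bdd_meas g -> bdd_meas (fun x => f x + g x).
Proof.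
move=> [mf [C fC]] [mg [C' gC]]; split; first exact: measurable_funD.
by exists (C + C') => x Dx; rewrite (le_trans (ler_normD _ _))// lerD// ?fC ?gC.
Qed.

Lemma bdd_measZ c f : bdd_meas f -> bdd_meas (fun x => c * f x).
Proof.
move=> [mf [C fC]]; split; first exact: measurable_funM.
by exists (`|c| * C) => x Dx; rewrite normrM ler_wpM2l// fC.
Qed.

Lemma mean_D f g : bdd_meas f -> bdd_meas g ->
  Rintegral mu E (fun x => f x + g x) = Rintegral mu E f + Rintegral mu E g.
Proof.
case: (um) => mE _ _ _ _ bf bg.
by rewrite RintegralD//; exact: bdd_meas_integrable.
Qed.

Lemma mean_Z c f : bdd_meas f ->
  Rintegral mu E (fun x => c * f x) = c * Rintegral mu E f.
Proof.
case: (um) => mE _ _ _ _ bf.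
by rewrite RintegralZl//; exact: bdd_meas_integrable.
Qed.

Lemma mean_between f a b : measurable_fun E f ->
  (forall x, D x -> a <= f x <= b) -> a <= Rintegral mu E f <= b.
Proof.
move=> mf fab; have bf := bdd_meas_between mf fab.
apply/andP; split.
  rewrite -[leLHS]mean_cst; apply: mean_le => //; first exact: bdd_meas_cst.
  by move=> x /fab /andP[].
rewrite -[leRHS]mean_cst; apply: mean_le => //; first exact: bdd_meas_cst.
by move=> x /fab /andP[].
Qed.

End Mean.

(** Tonelli's theorem concerns nonnegative integrands, hence the split into positive and negative
    parts. No integrability in [y] is assumed. *)
Lemma measurable_Rintegral_param d1 d2 (X : measurableType d1)
    (Y : measurableType d2) (R : realType) (P : probability Y R)
    (f : X * Y -> R) :
  measurable_fun setT f ->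
  measurable_fun setT (fun x => Rintegral P setT (fun y => f (x, y))).
Proof.
move=> mf; have mEf : measurable_fun setT (EFin \o f) by exact/measurable_EFinP.
rewrite /Rintegral; apply: measurableT_comp => //.
rewrite (_ : (fun x => _) = (fun x => \int[P]_y ((EFin \o f)^\+%E (x, y))
   - \int[P]_y ((EFin \o f)^\-%E (x, y)))%E); last first.
  apply/funext => x; rewrite integralE.
  by congr (_ - _)%E; apply: eq_integral => y _; rewrite ?funeposE ?funenegE.
apply: emeasurable_funB.
  apply: (measurable_fun_fubini_tonelli_F ((EFin \o f)^\+%E)) => //.
  exact: measurable_funepos.
apply: (measurable_fun_fubini_tonelli_F ((EFin \o f)^\-%E)) => //.
exact: measurable_funeneg.
Qed.

(** * Iterated expectations over i.i.d. rounds *)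

Section IteratedMean.
Variables (R : realType) (F G : probability R R) (D : set R).
Hypotheses (umF : unit_mass F setT D) (umG : unit_mass G setT D).

(** Two-coordinate analogue of [iidE3_measurable]. For throttling admissibility is part of the
    model; for pacing it has to be proved. *)
Fixpoint iidE2_measurable (n : nat) (f : seq (R * R) -> R) : Prop :=
  match n with
  | 0 => True
  | n'.+1 =>
      [/\ measurable_fun setT (fun v => Rintegral G setT (fun p =>
            iidE2 F G n' (fun s => f ((v, p) :: s)))),
          (forall v, measurable_fun setT (fun p =>
            iidE2 F G n' (fun s => f ((v, p) :: s)))) &
          forall v p, iidE2_measurable n' (fun s => f ((v, p) :: s))]
  end.

Definition in_support (n : nat) (s : seq (R * R)) : Prop :=
  size s = n /\ forall x, x \in s -> D x.1 /\ D x.2.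

Lemma in_support_cons n v p s :
  D v -> D p -> in_support n s -> in_support n.+1 ((v, p) :: s).
Proof.
move=> Dv Dp [sn sD]; split=> /= [|x]; first by rewrite sn.
by rewrite inE => /predU1P[->|/sD].
Qed.

Lemma iidE2_between n f a b : iidE2_measurable n f ->
  (forall s, in_support n s -> a <= f s <= b) -> a <= iidE2 F G n f <= b.
Proof.
elim: n f => [|n IH] f /=; first by move=> _; apply; split.
move=> [m1 m2 m3] fab; apply: (mean_between umF) => // v Dv.
apply: (mean_between umG) => // p Dp.
by apply: IH => // s sn; apply: fab; exact: in_support_cons.
Qed.

Lemma iidE2_le n f g a b : iidE2_measurable n f -> iidE2_measurable n g ->
  (forall s, in_support n s -> [/\ a <= f s, f s <= g s & g s <= b]) ->
  iidE2 F G n f <= iidE2 F G n g.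
Proof.
elim: n f g => [|n IH] f g /=; first by move=> _ _ /(_ [::])[]//; split.
move=> [m1 m2 m3] [m1' m2' m3'] fg.
have fab v p : D v -> D p -> a <= iidE2 F G n (fun s => f ((v, p) :: s)) <= b.
  move=> Dv Dp; apply: iidE2_between => // s sn.
  by have [->/= /le_trans h /h] := fg _ (in_support_cons Dv Dp sn).
have gab v p : D v -> D p -> a <= iidE2 F G n (fun s => g ((v, p) :: s)) <= b.
  move=> Dv Dp; apply: iidE2_between => // s sn.
  by have [/le_trans h /h -> ->] := fg _ (in_support_cons Dv Dp sn).
apply: (mean_le umF) => [||v Dv].
- apply: (bdd_meas_between (a := a) (b := b)) => // v Dv.
  by apply: (mean_between umG) => // p Dp; exact: fab.
- apply: (bdd_meas_between (a := a) (b := b)) => // v Dv.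
  by apply: (mean_between umG) => // p Dp; exact: gab.
apply: (mean_le umG) => [||p Dp].
- by apply: (bdd_meas_between (a := a) (b := b)) => // p Dp; exact: fab.
- by apply: (bdd_meas_between (a := a) (b := b)) => // p Dp; exact: gab.
by apply: IH => // s sn; apply: fg; exact: in_support_cons.
Qed.

Section StateMachine.
Context d (X : measurableType d).
Variables (f : X -> seq (R * R) -> R) (step : X * R * R -> X).
Hypothesis f_nil : measurable_fun setT (fun x => f x [::]).
Hypothesis mstep : measurable_fun setT step.
Hypothesis f_cons : forall x v p s, f x ((v, p) :: s) = f (step (x, v, p)) s.

(** Joint measurability in the starting state is what makes the induction go through: one more round
    composes with [step] and integrates out [p], then [v]. *)
Lemma measurable_iidE2_state n :
  measurable_fun setT (fun x => iidE2 F G n (f x)).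
Proof.
elim: n => [|n IH] //=.
have m : measurable_fun setT ((fun x => iidE2 F G n (f x)) \o step).
  exact: measurableT_comp.
have := measurable_Rintegral_param F (measurable_Rintegral_param G m).
apply: eq_measurable_fun => x _ /=.
apply: eq_Rintegral => v _; apply: eq_Rintegral => p _.
by congr iidE2; apply/funext => s; rewrite f_cons.
Qed.

Lemma iidE2_measurable_state n x : iidE2_measurable n (f x).
Proof.
elim: n x => [|n IH] x //=.
have fE v p : (fun s => f x ((v, p) :: s)) = f (step (x, v, p)).
  by apply/funext => s; rewrite f_cons.
have m : measurable_fun setT ((fun x => iidE2 F G n (f x)) \o step).
  by apply: measurableT_comp => //; exact: measurable_iidE2_state.
split.
- have := measurableT_comp (measurable_Rintegral_param G m) (pair1_measurable x).
  apply: eq_measurable_fun => v _ /=.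
  by apply: eq_Rintegral => p _; rewrite fE.
- move=> v; have := measurableT_comp m (pair1_measurable (x, v)).
  by apply: eq_measurable_fun => p _ /=; rewrite fE.
- by move=> v p; rewrite fE.
Qed.
End StateMachine.
End IteratedMean.

(** * Pacing as online gradient descent *)

(** Inversion is continuous on the open complement of 0, and a singleton imposes nothing. This
    serves the bid [v / (1 + mu)], where [mu] ranges over all reals once it is a state
    coordinate. *)
Lemma measurable_inv (R : realType) : measurable_fun [set: R] (@GRing.inv R).
Proof.
have -> : [set: R] = [set~ 0] `|` [set 0] by rewrite setUC setUv.
apply/measurable_funU; [exact: measurableC | by [] | split].
  apply: open_continuous_measurable_fun => [|x].
    apply: closed_openC; apply: accessible_closed_set1.
    exact/hausdorff_accessible/Rhausdorff.
  by rewrite inE => x0; apply: inv_continuous; exact/eqP.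
exact: measurable_fun_set1.
Qed.

Section Pacing.
Variables (R : realType) (F G : probability R R) (vbar rho eps mubar : R).
Hypotheses (vbar0 : 0 < vbar) (rho0 : 0 < rho) (rho_vbar : rho <= vbar).
Hypotheses (eps0 : 0 < eps) (rho_mubar : vbar / rho <= mubar).
Implicit Types (mu Bt v p w : R) (s : seq (R * R)) (n : nat).
Let D : set R := [set` `[0, vbar]].

Definition lagrangian (mu v p : R) : R := Num.max (v - (1 + mu) * p) 0 + mu * rho.

Definition dual (mu : R) : R :=
  Rintegral F setT (fun v => Rintegral G setT (fun p => lagrangian mu v p)).

Definition win (mu Bt v p : R) : bool := p <= Num.min (v / (1 + mu)) Bt.
Definition gain mu Bt v p : R := if win mu Bt v p then v - p else 0.
Definition expense mu Bt v p : R := if win mu Bt v p then p else 0.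
Definition next_mu mu Bt v p : R :=
  proj_int 0 mubar (mu - eps * (rho - expense mu Bt v p)).

(* The Lagrangian value collected along the pacing trajectory; every round after
   the budget has dropped below [vbar] is credited [vbar]. *)
Fixpoint dual_rev (mu Bt : R) (s : seq (R * R)) : R :=
  match s with
  | [::] => 0
  | (v, p) :: s' =>
      if vbar <= Bt then
        lagrangian mu v p +
        dual_rev (next_mu mu Bt v p) (Bt - expense mu Bt v p) s'
      else vbar + dual_rev mu Bt s'
  end.

Lemma pac_rev_cons mu Bt v p s :
  pac_rev rho eps mubar mu Bt ((v, p) :: s) = gain mu Bt v p +
    pac_rev rho eps mubar (next_mu mu Bt v p) (Bt - expense mu Bt v p) s.
Proof. by []. Qed.

Local Notation mdom mu := (0 <= mu <= mubar).

Lemma mubar_gt0 : 0 < mubar.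
Proof. by rewrite (lt_le_trans _ rho_mubar)// divr_gt0. Qed.

Lemma next_mu_dom mu Bt v p : mdom (next_mu mu Bt v p).
Proof.
rewrite /next_mu /proj_int le_min le_max lexx orbT ge_min lexx orbT !andbT.
exact: ltW mubar_gt0.
Qed.

(** Nonexpansiveness of the projection, on which the regret bound of gradient descent rests. *)
Lemma sqr_proj_int (b x w : R) : 0 <= w <= b ->
  (proj_int 0 b x - w) ^+ 2 <= (x - w) ^+ 2.
Proof.
rewrite /proj_int => /andP[w0 wb]; rewrite -subr_ge0.
by case: (leP x 0) => h1; [case: (leP 0 b)|case: (leP x b)] => h2; nra.
Qed.

Lemma expense_bounds mu Bt v p : 0 <= Bt -> D p ->
  0 <= expense mu Bt v p <= vbar /\ expense mu Bt v p <= Bt.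
Proof.
rewrite /D /expense /win /= in_itv /= le_min => B0 /andP[p0 pv].
by case: ifP => [/andP[_ pB]|_]; split; lra.
Qed.

Lemma gain_bounds mu Bt v p : 0 <= mu -> D v -> D p ->
  0 <= gain mu Bt v p <= vbar.
Proof.
rewrite /D /gain /win /= !in_itv /= le_min => mu0 /andP[v0 vv] /andP[p0 pv].
have mu1 : 0 < 1 + mu by lra.
by case: ifP => [/andP[]|_]; rewrite ?ler_pdivlMr// => *; nra.
Qed.

(** While the budget covers every possible price, winning is the event [(1 + mu) * p <= v], on which
    the positive part in [lagrangian] is attained. The factor [rho - expense] is the subgradient in
    [mu] that drives [next_mu]. *)
Lemma gain_lagrangian mu Bt v p : 0 <= mu -> vbar <= Bt -> D v -> D p ->
  gain mu Bt v p = lagrangian mu v p - mu * (rho - expense mu Bt v p).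
Proof.
rewrite /D /gain /expense /win /lagrangian /= !in_itv /= le_min.
move=> mu0 vB /andP[v0 vv] /andP[p0 pv].
have -> : p <= Bt by lra.
rewrite andbT ler_pdivlMr; last by lra.
by rewrite mulrC; case: leP => h; case: leP => h'; lra.
Qed.

Lemma lagrangian_bounds mu v p : mdom mu -> D v -> D p ->
  0 <= lagrangian mu v p <= vbar + mubar * rho.
Proof.
rewrite /D /lagrangian /= !in_itv /=.
move=> /andP[m0 m1] /andP[v0 vv] /andP[p0 pv].
have ? : 0 <= mu * rho <= mubar * rho by rewrite mulr_ge0 ?ler_wpM2r// ltW.
have ? : 0 <= (1 + mu) * p by rewrite mulr_ge0//; lra.
by case: (leP (v - (1 + mu) * p) 0) => h; lra.
Qed.

Lemma in_support_consP n v p s : in_support D n ((v, p) :: s) ->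
  exists m, [/\ n = m.+1, D v, D p & in_support D m s].
Proof.
move=> [<- sD]; exists (size s); have [Dv Dp] := sD (v, p) (mem_head _ _).
by split=> //; split=> // x xs; apply: sD; rewrite inE xs orbT.
Qed.

Lemma pac_rev_bounds n mu Bt s : mdom mu -> 0 <= Bt -> in_support D n s ->
  0 <= pac_rev rho eps mubar mu Bt s <= vbar * n%:R.
Proof.
elim: s n mu Bt => [|[v p] s IH] n mu Bt m B0 sn.
  by rewrite /= lexx mulr_ge0// ltW.
have [k [-> Dv Dp sk]] := in_support_consP sn; rewrite pac_rev_cons.
have /andP[g0 g1] := gain_bounds Bt (andP m).1 Dv Dp.
have [/andP[e0 e1] eB] := expense_bounds mu v B0 Dp.
have B1 : 0 <= Bt - expense mu Bt v p by lra.
have /andP[] := IH _ _ _ (next_mu_dom mu Bt v p) B1 sk.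
by rewrite -addn1 natrD; lra.
Qed.

Lemma dual_rev_bounds n mu Bt s : mdom mu -> in_support D n s ->
  0 <= dual_rev mu Bt s <= (vbar + mubar * rho) * n%:R.
Proof.
have mr : 0 < mubar * rho by rewrite mulr_gt0 ?mubar_gt0.
elim: s n mu Bt => [|[v p] s IH] n mu Bt m sn.
  by rewrite /= lexx mulr_ge0// addr_ge0 ?ltW.
have [k [-> Dv Dp sk]] := in_support_consP sn; rewrite /= -addn1 natrD mulrDr.
case: ifP => _; last by have := vbar0; have := IH _ _ Bt m sk; lra.
have := IH _ _ (Bt - expense mu Bt v p) (next_mu_dom mu Bt v p) sk.
by have := lagrangian_bounds m Dv Dp; lra.
Qed.

Lemma dual_rev_depleted mu Bt s : Bt < vbar -> dual_rev mu Bt s = vbar * (size s)%:R.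
Proof.
move=> Bv; elim: s => [|[v p] s IH] /=; first by rewrite mulr0.
by rewrite leNgt Bv /= IH -[in RHS]addn1 natrD; lra.
Qed.

(* Regret of online gradient descent against the comparator [w]: [w = 0] is used
   on trajectories that end with enough budget, and [w = vbar / rho] on those
   that run out of it. *)
Lemma dual_rev_pac_rev n mu Bt s : mdom mu -> 0 <= Bt -> in_support D n s ->
  exists w, (w = 0 \/ w = vbar / rho) /\
    2 * eps * (dual_rev mu Bt s - pac_rev rho eps mubar mu Bt s) <=
      (mu - w) ^+ 2 + n%:R * (eps * vbar) ^+ 2 +
      2 * eps * (w * (rho * n%:R - Bt + vbar)).
Proof.
have u0 : 0 < vbar / rho by rewrite divr_gt0.
have ur : vbar / rho * rho = vbar by rewrite divfK// gt_eqF.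
have [v0 r0 rv e0] := And4 vbar0 rho0 rho_vbar eps0.
elim: s n mu Bt => [|[v p] s IH] n mu Bt m B0 sn.
  (* The comparator 0 cancels the budget term, however much budget is left over. *)
  exists 0; split; [by left|]; rewrite /= !(mul0r, mulr0, addr0, subr0).
  by apply: addr_ge0; [exact: sqr_ge0|rewrite mulr_ge0 ?sqr_ge0].

have [k [nE Dv Dp sk]] := in_support_consP sn.
have [vB|Bv] := leP vbar Bt; last first.
  (* With [w = vbar / rho] the budget term equals [vbar * n] plus a nonnegative multiple of
     [vbar - Bt], so it pays for the whole credit of the remaining rounds; the revenue of pacing is
     merely bounded below by 0. *)
  exists (vbar / rho); split; [by right|].
  have /andP[P0 _] := pac_rev_bounds m B0 sn.
  rewrite dual_rev_depleted// sn.1.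
  set u := vbar / rho in u0 ur *; set P := pac_rev _ _ _ _ _ _ in P0 *.
  have -> : u * (rho * n%:R - Bt + vbar) = vbar * n%:R + u * (vbar - Bt).
    by rewrite -ur; ring.
  have ? : 0 <= u * (vbar - Bt) by rewrite mulr_ge0//; lra.
  have ? : 0 <= n%:R * (eps * vbar) ^+ 2 by rewrite mulr_ge0 ?sqr_ge0.
  have ? := sqr_ge0 (mu - u).
  have ? : 0 <= eps * P by rewrite mulr_ge0// ltW.
  have ? : 0 <= eps * (u * (vbar - Bt)) by rewrite mulr_ge0// ltW.
  by lra.
have [/andP[z0 z1] eB] := expense_bounds mu v B0 Dp.
have B1 : 0 <= Bt - expense mu Bt v p by lra.
have [w [ww le_w]] := IH _ _ _ (next_mu_dom mu Bt v p) B1 sk.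
exists w; split=> //; rewrite pac_rev_cons gain_lagrangian ?(andP m).1//= vB.
(* The cap [vbar / rho <= mubar] keeps the comparator inside the projection interval. *)
have wb : 0 <= w <= mubar.
  by case: ww => ->; [rewrite lexx ltW ?mubar_gt0|rewrite (ltW u0)].
have := sqr_proj_int (mu - eps * (rho - expense mu Bt v p)) wb.
rewrite -/(next_mu mu Bt v p); move: le_w.
set z := expense mu Bt v p in z0 z1 *; set m' := next_mu mu Bt v p.
set A := dual_rev _ _ _; set P := pac_rev _ _ _ _ _ _.
rewrite nE -addn1 natrD => le_w le_m.
have ? : (eps * (rho - z)) ^+ 2 <= (eps * vbar) ^+ 2.
  by rewrite !exprMn ler_wpM2l ?sqr_ge0//; nra.
(* The expansion yields [2 * eps * (mu - w) * (rho - z)]; the missing [2 * eps * w * (rho - z)] is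
   exactly the change of the budget term over this round. *)
have -> : (mu - w) ^+ 2 = (mu - eps * (rho - z) - w) ^+ 2
   + 2 * eps * (mu - w) * (rho - z) - (eps * (rho - z)) ^+ 2 by ring.
by lra.
Qed.

End Pacing.

(** Induction step for lower bounds on the horizon: [K] is what the other rounds guarantee, [phi]
    the contribution of the first one. The bounds [a], [b], [a'], [b'] provide integrability. *)
Lemma iidE2_step_ge (R : realType) (F G : probability R R) (D : set R) n
    (f : seq (R * R) -> R) (phi : R * R -> R) (K a b a' b' : R) :
  unit_mass F setT D -> unit_mass G setT D ->
  iidE2_measurable F G n.+1 f ->
  (forall s, in_support D n.+1 s -> a <= f s <= b) ->
  measurable_fun setT phi ->
  (forall v p, D v -> D p -> a' <= phi (v, p) <= b') ->
  (forall v p, D v -> D p ->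
     K + phi (v, p) <= iidE2 F G n (fun s => f ((v, p) :: s))) ->
  K + Rintegral F setT (fun v => Rintegral G setT (fun p => phi (v, p))) <=
    iidE2 F G n.+1 f.
Proof.
move=> umF umG [m1 m2 m3] fab mphi phiab le_phi /=.
have mphi1 v : measurable_fun setT (fun p => phi (v, p)).
  exact: measurableT_comp mphi (pair1_measurable v).
have bphi1 v : D v -> bdd_meas setT D (fun p => phi (v, p)).
  by move=> Dv; apply: (bdd_meas_between (a := a') (b := b')) => // p; exact: phiab.
have mphi2 := measurable_Rintegral_param G mphi.
have bphi2 : bdd_meas setT D (fun v => Rintegral G setT (fun p => phi (v, p))).
  apply: (bdd_meas_between (a := a') (b := b')) => // v Dv.
  by apply: (mean_between umG) => // p; exact: phiab.
have fabn v p : D v -> D p -> a <= iidE2 F G n (fun s => f ((v, p) :: s)) <= b.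
  move=> Dv Dp; apply: (iidE2_between umF umG (m3 v p)) => s sn.
  by apply: fab; exact: in_support_cons.
have addK mu (um : unit_mass mu setT D) h : bdd_meas setT D h ->
    K + Rintegral mu setT h = Rintegral mu setT (fun x => K + h x).
  by move=> bh; rewrite (mean_D um (bdd_meas_cst _ _ _) bh) (mean_cst um).
rewrite (addK F)//.
apply: (mean_le umF) => [||v Dv].
- by apply: bdd_measD => //; exact: bdd_meas_cst.
- apply: (bdd_meas_between (a := a) (b := b)) => // v Dv.
  by apply: (mean_between umG) => // p; exact: fabn.
rewrite (addK G)//; last exact: bphi1.
apply: (mean_le umG) => [||p Dp].
- by apply: bdd_measD; [exact: bdd_meas_cst|exact: bphi1].
- by apply: (bdd_meas_between (a := a) (b := b)) => // p; exact: fabn.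
exact: le_phi.
Qed.

(** * Expected revenue of pacing *)

Section PacingMean.
Variables (R : realType) (F G : probability R R) (vbar rho eps mubar : R).
Hypotheses (vbar0 : 0 < vbar) (rho0 : 0 < rho).
Hypothesis rho_mubar : vbar / rho <= mubar.
Let D : set R := [set` `[0, vbar]].
Hypotheses (umF : unit_mass F setT D) (umG : unit_mass G setT D).

Section Measurability.
Context d (Y : measurableType d).
Variables mu Bt v p : Y -> R.
Hypotheses (mmu : measurable_fun setT mu) (mBt : measurable_fun setT Bt).
Hypotheses (mv : measurable_fun setT v) (mp : measurable_fun setT p).

Lemma measurable_win :
  measurable_fun setT (fun y => win (mu y) (Bt y) (v y) (p y)).
Proof.
apply: measurable_fun_ler => //; apply: measurable_minr => //.
apply: measurable_funM => //; apply: measurableT_comp (@measurable_inv R) _.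
exact: measurable_funD.
Qed.

Lemma measurable_gain :
  measurable_fun setT (fun y => gain (mu y) (Bt y) (v y) (p y)).
Proof.
apply: measurable_fun_ifT => //; first exact: measurable_win.
exact: measurable_funB.
Qed.

Lemma measurable_expense :
  measurable_fun setT (fun y => expense (mu y) (Bt y) (v y) (p y)).
Proof. by apply: measurable_fun_ifT => //; exact: measurable_win. Qed.

Lemma measurable_next_mu :
  measurable_fun setT (fun y => next_mu rho eps mubar (mu y) (Bt y) (v y) (p y)).
Proof.
apply: measurable_minr => //; apply: measurable_maxr => //.
apply: measurable_funB => //; apply: measurable_funM => //.
by apply: measurable_funB => //; exact: measurable_expense.
Qed.

Lemma measurable_lagrangian :
  measurable_fun setT (fun y => lagrangian rho (mu y) (v y) (p y)).
Proof.
apply: measurable_funD; last exact: measurable_funM.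
apply: measurable_maxr => //; apply: measurable_funB => //.
by apply: measurable_funM => //; exact: measurable_funD.
Qed.
End Measurability.

Local Notation mdom mu := (0 <= mu <= mubar).
Local Notation pac := (pac_rev rho eps mubar).
Local Notation drev := (dual_rev vbar rho eps mubar).

(** Coordinates of the argument of the state transition: collected revenue, multiplier, budget,
    value, price. *)
Let x1 (y : R * R * R * R * R) := y.1.1.1.1.
Let x2 (y : R * R * R * R * R) := y.1.1.1.2.
Let x3 (y : R * R * R * R * R) := y.1.1.2.
Let x4 (y : R * R * R * R * R) := y.1.2.
Let x5 (y : R * R * R * R * R) := y.2.
Let mx1 : measurable_fun setT x1.
Proof.
exact: (measurableT_comp measurable_fst (measurableT_comp measurable_fst
  (measurableT_comp measurable_fst measurable_fst))).
Qed.
Let mx2 : measurable_fun setT x2.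
Proof.
exact: (measurableT_comp measurable_snd (measurableT_comp measurable_fst
  (measurableT_comp measurable_fst measurable_fst))).
Qed.
Let mx3 : measurable_fun setT x3.
Proof.
exact: (measurableT_comp measurable_snd
  (measurableT_comp measurable_fst measurable_fst)).
Qed.
Let mx4 : measurable_fun setT x4.
Proof. exact: (measurableT_comp measurable_snd measurable_fst). Qed.
Let mx5 : measurable_fun setT x5.
Proof. exact: (measurable_snd). Qed.

(** Storing the collected revenue [c] in the state lets it be read off after the last round, so that
    [pac_rev] becomes a state machine. *)
Lemma pac_rev_iidE2_measurable n (c mu Bt : R) :
  iidE2_measurable F G n (fun s => c + pac mu Bt s).
Proof.
apply: (@iidE2_measurable_state _ _ _ _ (R * R * R)%type
  (fun x s => x.1.1 + pac x.1.2 x.2 s)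
  (fun y => (x1 y + gain (x2 y) (x3 y) (x4 y) (x5 y),
             next_mu rho eps mubar (x2 y) (x3 y) (x4 y) (x5 y),
             x3 y - expense (x2 y) (x3 y) (x4 y) (x5 y))) _ _ _ n (c, mu, Bt)).
- apply: measurable_funD => //=; exact: measurableT_comp.
- apply: measurable_fun_pair; first apply: measurable_fun_pair.
  + by apply: measurable_funD => //; exact: measurable_gain.
  + exact: measurable_next_mu.
  + by apply: measurable_funB => //; exact: measurable_expense.
- by move=> [[c' m'] B'] v p s; rewrite /= addrA.
Qed.

Lemma dual_rev_iidE2_measurable n (c mu Bt : R) :
  iidE2_measurable F G n (fun s => c + drev mu Bt s).
Proof.
apply: (@iidE2_measurable_state _ _ _ _ (R * R * R)%type
  (fun x s => x.1.1 + drev x.1.2 x.2 s)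
  (fun y => if vbar <= x3 y then
             (x1 y + lagrangian rho (x2 y) (x4 y) (x5 y),
             next_mu rho eps mubar (x2 y) (x3 y) (x4 y) (x5 y),
             x3 y - expense (x2 y) (x3 y) (x4 y) (x5 y)) else
             (x1 y + vbar, x2 y, x3 y)) _ _ _ n (c, mu, Bt)).
- apply: measurable_funD => //=; exact: measurableT_comp.
- apply: measurable_fun_ifT; first exact: measurable_fun_ler.
    apply: measurable_fun_pair; first apply: measurable_fun_pair.
    + by apply: measurable_funD => //; exact: measurable_lagrangian.
    + exact: measurable_next_mu.
    + by apply: measurable_funB => //; exact: measurable_expense.
  apply: measurable_fun_pair => //; apply: measurable_fun_pair => //.
  exact: measurable_funD.
- move=> [[c' m'] B'] v p s; rewrite /x1 /x2 /x3 /x4 /x5 /=.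
  by case: ifP => /= _; rewrite addrA.
Qed.

(** Given the past, a round contributes on average [dual] at the current multiplier, or [vbar] after
    depletion; both are at least [dlow]. Crediting depleted rounds thus avoids any stopping time.
    The offset [c] is general so that it can absorb the first round in the induction. *)
Lemma dual_rev_mean_ge n (c mu Bt dlow : R) : mdom mu ->
  (forall m : R, mdom m -> dlow <= dual F G rho m) -> dlow <= vbar ->
  c + n%:R * dlow <= iidE2 F G n (fun s => c + drev mu Bt s).
Proof.
move=> mum dlowP dlowv; elim: n c mu Bt mum => [|n IH] c mu Bt mum.
  by rewrite /= mul0r.
have mono := @dual_rev_bounds R vbar rho eps mubar vbar0 rho0 rho_mubar n.+1 mu Bt.
set C := (_ * n.+1%:R) in mono.
have fab s : in_support D n.+1 s -> c <= c + drev mu Bt s <= c + C.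
  by move=> /(mono s mum) /andP[d0 d1]; rewrite lerDl lerD2l d0 d1.
have me := dual_rev_iidE2_measurable n.+1 c mu Bt.
have [vB|Bv] := leP vbar Bt.
  have := @iidE2_step_ge _ F G D n _ (fun x => lagrangian rho mu x.1 x.2)
    (c + n%:R * dlow) _ _ 0 (vbar + mubar * rho) umF umG me fab.
  rewrite -/(dual F G rho mu) => h; apply: le_trans (h _ _ _).
  - by have := dlowP _ mum; rewrite -natr1; lra.
  - exact: measurable_lagrangian.
  - by move=> v p Dv Dp; exact: (@lagrangian_bounds R vbar).
  move=> v p Dv Dp; rewrite /= vB addrAC.
  under [X in _ <= iidE2 _ _ _ X]eq_fun do rewrite addrA.
  by apply: IH; exact: (next_mu_dom _ vbar0 rho0 rho_mubar).
have := @iidE2_step_ge _ F G D n _ (fun=> vbar)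
    (c + n%:R * dlow) _ _ vbar vbar umF umG me fab.
rewrite (mean_cst umG) (mean_cst umF) => h; apply: le_trans (h _ _ _).
- by rewrite -natr1; lra.
- exact: measurable_cst.
- by rewrite lexx.
move=> v p Dv Dp; rewrite /= (leNgt vbar Bt) Bv /= addrAC.
under [X in _ <= iidE2 _ _ _ X]eq_fun do rewrite addrA.
exact: IH.
Qed.

Lemma pac_mean_ge n (mu Bt dlow slack : R) : mdom mu -> 0 <= Bt ->
  (forall m : R, mdom m -> dlow <= dual F G rho m) -> dlow <= vbar ->
  (forall s, in_support D n s -> drev mu Bt s - slack <= pac mu Bt s) ->
  n%:R * dlow - slack <= iidE2 F G n (pac mu Bt).
Proof.
move=> mum B0 dlowP dlowv le_s; rewrite addrC.
apply: le_trans (dual_rev_mean_ge n (- slack) Bt mum dlowP dlowv) _.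
have -> : pac mu Bt = (fun s => 0 + pac mu Bt s).
  by apply/funext => s; rewrite add0r.
have bd := dual_rev_bounds eps vbar0 rho0 rho_mubar Bt mum.
have bp := pac_rev_bounds eps vbar0 rho0 rho_mubar mum B0.
apply: (@iidE2_le _ F G D umF umG n _ _ (- slack) (vbar * n%:R)).
- exact: dual_rev_iidE2_measurable.
- exact: pac_rev_iidE2_measurable.
move=> s sn; have := bd n s sn; have := bp n s sn; have := le_s s sn.
by rewrite add0r => ? ? ?; split; lra.
Qed.

Lemma pac_mean_le n (mu Bt : R) : mdom mu -> 0 <= Bt ->
  iidE2 F G n (pac mu Bt) <= vbar * n%:R.
Proof.
move=> mum B0; have -> : pac mu Bt = (fun s => 0 + pac mu Bt s).
  by apply/funext => s; rewrite add0r.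
suff /andP[]: 0 <= iidE2 F G n (fun s => 0 + pac mu Bt s) <= vbar * n%:R by [].
apply: (@iidE2_between _ F G D) => //; first exact: pac_rev_iidE2_measurable.
by move=> s sn; rewrite add0r; exact: (pac_rev_bounds eps vbar0 rho0 rho_mubar mum B0 sn).
Qed.
End PacingMean.

(** * Upper bound for throttling *)

(* A randomized decision [S] need not be measurable; some [q], lying between its
   inner and outer probabilities, still plays the role of its probability. *)
Lemma randomized_choice_mean d (Y : measurableType d) (R : realType)
    (mu : {measure set Y -> \bar R}) (E D : set Y) (S : Y -> bool) :
  unit_mass mu E D ->
  exists2 q : R, 0 <= q <= 1 & forall (J : Y -> R) (K w : R), bdd_meas E D J ->
    (forall y, D y -> J y <= K + (if S y then w else 0)) ->
    Rintegral mu E J <= K + q * w.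
Proof.
move=> um.
(* The witness [q = sup A] is the lower integral of the indicator of [S], a supremum over bounded
   measurable minorants. *)
pose A := [set a : R | exists l : Y -> R, [/\ bdd_meas E D l,
  forall y, D y -> l y <= (if S y then 1 else 0) & a = Rintegral mu E l]].
have A0 : A 0.
  exists (fun=> 0); split; first exact: bdd_meas_cst.
  - by move=> y _; case: ifP.
  - by rewrite (mean_cst um).
have A1 : ubound A 1.
  move=> _ [l [bl lS ->]]; rewrite -[leRHS](mean_cst um).
  apply: (mean_le um) => //; first exact: bdd_meas_cst.
  by move=> y /lS /le_trans; apply; case: ifP.
have supA : has_sup A by split; [exists 0 | exists 1].
exists (sup A).
  by rewrite (sup_upper_bound supA)//= ge_sup//; exists 0.
move=> J K w bJ JS.
(* The hypothesis on [J] solved for the indicator: if [w > 0], [l] is itself a minorant; if [w < 0],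
   division reverses the order and [l] dominates every minorant. *)
pose l y := w^-1 * (J y + - K).
have bl : bdd_meas E D l by apply/bdd_measZ/bdd_measD => //; exact: bdd_meas_cst.
have il : Rintegral mu E l = w^-1 * (Rintegral mu E J - K).
  rewrite (mean_Z um) ?(mean_D um) ?(mean_cst um)//; try exact: bdd_meas_cst.
  by apply: bdd_measD => //; exact: bdd_meas_cst.
have [w0|w0|w0] := ltgtP w 0.
- have wl y : D y -> (if S y then 1 else 0) <= l y.
    move=> /JS; rewrite /l ler_ndivlMl//.
    by case: ifP => _; lra.
  have : sup A <= Rintegral mu E l.
    apply: ge_sup; first by exists 0.
    move=> _ [l' [bl' l'S ->]]; apply: (mean_le um) => // y Dy.
    exact: le_trans (l'S y Dy) (wl y Dy).
  by rewrite il ler_ndivlMl//; lra.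
- have : Rintegral mu E l <= sup A.
    apply: (sup_upper_bound supA); exists l; split=> // y /JS.
    rewrite /l ler_pdivrMl//; case: ifP => _; lra.
  by rewrite il ler_pdivrMl//; lra.
- rewrite w0 mulr0 addr0 -[leRHS](mean_cst um).
  apply: (mean_le um) => //; first exact: bdd_meas_cst.
  by move=> y /JS; rewrite w0 if_same addr0.
Qed.

Section Throttling.
Variables (R : realType) (F G : probability R R) (vbar : R).
Let D : set R := [set` `[0, vbar]].
Hypotheses (umF : unit_mass F setT D) (umG : unit_mass G setT D).
Hypothesis (vbar0 : 0 < vbar).

Definition value (v p : R) : R := Num.max (v - p) 0.
Definition cost (v p : R) : R := if p <= v then p else 0.

Lemma measurable_value :
  measurable_fun setT (fun x : R * R => value x.1 x.2).
Proof. by apply: measurable_maxr => //; exact: measurable_funB. Qed.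

Lemma measurable_cost : measurable_fun setT (fun x : R * R => cost x.1 x.2).
Proof. by apply: measurable_fun_ifT => //; exact: measurable_fun_ler. Qed.

Lemma measurable_rfun : measurable_fun setT (rfun G).
Proof. exact: measurable_Rintegral_param measurable_value. Qed.

Lemma measurable_cfun : measurable_fun setT (cfun G).
Proof. exact: measurable_Rintegral_param measurable_cost. Qed.

Lemma value_bounds v p : D v -> D p -> 0 <= value v p <= v.
Proof.
rewrite /D /value /= !in_itv /= => /andP[v0 v1] /andP[p0 p1].
by case: (leP (v - p) 0) => h; lra.
Qed.

Lemma cost_bounds v p : D v -> D p -> 0 <= cost v p <= v.
Proof.
rewrite /D /cost /= !in_itv /= => /andP[v0 v1] /andP[p0 p1].
by case: ifP => h; lra.
Qed.

Lemma bdd_value v : D v -> bdd_meas setT D (value v).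
Proof.
move=> Dv; apply: (bdd_meas_between (a := 0) (b := v)) => [|p]; last exact: value_bounds.
exact: measurableT_comp measurable_value (pair1_measurable v).
Qed.

Lemma bdd_cost v : D v -> bdd_meas setT D (cost v).
Proof.
move=> Dv; apply: (bdd_meas_between (a := 0) (b := v)) => [|p]; last exact: cost_bounds.
exact: measurableT_comp measurable_cost (pair1_measurable v).
Qed.

Lemma rfun_bounds v : D v -> 0 <= rfun G v <= v.
Proof.
move=> Dv; apply: (mean_between umG) => [|p]; last exact: value_bounds.
by case: (bdd_value Dv).
Qed.

Lemma cfun_bounds v : D v -> 0 <= cfun G v <= v.
Proof.
move=> Dv; apply: (mean_between umG) => [|p]; last exact: cost_bounds.
by case: (bdd_cost Dv).
Qed.

Definition surplus (lam v : R) : R := Num.max (rfun G v - lam * cfun G v) 0.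

Lemma measurable_surplus lam : measurable_fun setT (surplus lam).
Proof.
apply: measurable_maxr => //; apply: measurable_funB; first exact: measurable_rfun.
by apply: measurable_funM => //; exact: measurable_cfun.
Qed.

Lemma surplus_bounds lam v : 0 <= lam -> D v -> 0 <= surplus lam v <= v.
Proof.
move=> lam0 Dv; have := rfun_bounds Dv; have /andP[c0 _] := cfun_bounds Dv.
have := mulr_ge0 lam0 c0; rewrite /surplus => ? ?.
by case: (leP (rfun G v - lam * cfun G v) 0) => h; lra.
Qed.

Lemma bdd_surplus lam : 0 <= lam -> bdd_meas setT D (surplus lam).
Proof.
move=> lam0; apply: (bdd_meas_between (a := 0) (b := vbar)) => [|v Dv].
  exact: measurable_surplus.
have := surplus_bounds lam0 Dv; move: Dv; rewrite /D /= in_itv /=; lra.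
Qed.

Lemma mean_surplus_ge0 lam : 0 <= Rintegral F setT (surplus lam).
Proof. by apply: Rintegral_ge0 => v _; rewrite /surplus le_max lexx orbT. Qed.

Notation leb := (@lebesgue_measure R).
Notation I01 := ([set` `[0%R, 1%R]] : set R).

Lemma unit_mass_lebesgue : unit_mass leb I01 I01.
Proof.
split=> //; first by rewrite setDv measure0.
have := lebesgue_measure_itv (`[0%R, 1%R] : interval R).
by rewrite /= lte_fin ltr01 sube0.
Qed.

Lemma iidE3_cst n (a : R) : iidE3 F G n (fun=> a) = a.
Proof.
elim: n => //= n ->.
by rewrite (mean_cst unit_mass_lebesgue) (mean_cst umG) (mean_cst umF).
Qed.

Lemma iidE3_measurable_cst n (a : R) : iidE3_measurable F G n (fun=> a).
Proof.
by elim: n => //= n IH.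
Qed.

Variables (full : bool) (beta : strategy R) (B lam : R).
Hypothesis lam0 : 0 <= lam.

(** Lagrangian relaxation, by induction on the rounds left: [a] is the revenue already collected,
    [lam * (B - spent)] prices the remaining budget, and [lam * vbar] is a reserve for the round
    that breaks it. The lower bound [a] supplies the boundedness needed for integrability. *)
Lemma thr_mean_bounds n (a : R) (H : hist R) (spent : R) : spent <= B ->
  iidE3_measurable F G n (fun s => a + thr_rev full beta B H spent s) ->
  a <= iidE3 F G n (fun s => a + thr_rev full beta B H spent s) <=
    a + n%:R * Rintegral F setT (surplus lam) + lam * (B - spent) + lam * vbar.
Proof.
set dd := Rintegral F setT (surplus lam).
have dd0 : 0 <= dd := mean_surplus_ge0 lam.
have [l0 v0] := conj lam0 vbar0.
have lv0 : 0 <= lam * vbar by rewrite mulr_ge0// ltW.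
elim: n a H spent => [|n IH] a H spent sB.
  have lB : 0 <= lam * (B - spent) by rewrite mulr_ge0//; lra.
  by move=> _ /=; rewrite addr0 mul0r addr0 lexx; lra.
move=> /= [m1 [m2 [m3 m4]]].
set J := fun v p g =>
  iidE3 F G n (fun s => a + thr_rev full beta B H spent ((v, p, g) :: s)).
set K := a + n%:R * dd + lam * (B - spent) + lam * vbar.
pose w v p := value v p + (- lam) * cost v p.
have ndd : 0 <= n%:R * dd by rewrite mulr_ge0.
have lB : 0 <= lam * (B - spent) by rewrite mulr_ge0//; lra.
have JP v p g : D v -> D p ->
    a <= J v p g <= K + (if beta H v g then w v p else 0).
  move=> Dv Dp; have := m4 v p g; rewrite /J /=.
  have /andP[va0 va1] := value_bounds Dv Dp; have /andP[co0 co1] := cost_bounds Dv Dp.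
  have vb : v <= vbar by move: Dv; rewrite /D /= in_itv => /andP[].
  have -> : (if beta H v g && (p <= v) then p else 0) =
            (if beta H v g then cost v p else 0) by case: beta.
  set pay := (if beta H v g then cost v p else 0).
  rewrite -/(value v p) /w; case: (boolP (spent + pay <= B)) => paid.
    under [X in iidE3_measurable _ _ _ X]eq_fun do rewrite addrA.
    under [X in iidE3 _ _ _ X]eq_fun do rewrite addrA.
    move=> /(IH _ _ _ paid); rewrite /K /pay.
    by case: (beta H v g) => /andP[h1 h2]; apply/andP; split; lra.
  (* Budget broken: this round and all later ones earn 0, and the reserve [lam * vbar] absorbs the
     cost of this round. *)
  move=> _; rewrite iidE3_cst addr0 lexx /=; move: paid; rewrite /pay -ltNge.
  case: (beta H v g) => paid; last by rewrite addr0 ltNge sB in paid.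
  have : 0 <= lam * (vbar - cost v p) by rewrite mulr_ge0//; lra.
  by rewrite /K; lra.
have wv v p : D v -> D p -> K + w v p <= K + vbar.
  move=> Dv Dp; have /andP[_ va1] := value_bounds Dv Dp.
  have /andP[co0 _] := cost_bounds Dv Dp; have := mulr_ge0 l0 co0.
  move: Dv; rewrite /w /D /= in_itv /= => /andP[_ ?] ?; lra.
have JP' v p g : D v -> D p -> a <= J v p g <= K + vbar.
  move=> Dv Dp; have /andP[-> /= h] := JP v p g Dv Dp.
  by apply: (le_trans h); case: ifP => _; [exact: wv|lra].
have bJ v p : D v -> D p -> bdd_meas I01 I01 (J v p).
  move=> Dv Dp; apply: (bdd_meas_between (a := a) (b := K + vbar)) => [|g _].
    exact: measurable_funTS (m3 v p).
  exact: JP'.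
have J2P v p : D v -> D p -> a <= Rintegral leb I01 (J v p) <= K + vbar.
  move=> Dv Dp; apply: (mean_between unit_mass_lebesgue); first by case: (bJ v p Dv Dp).
  by move=> g _; exact: JP'.
have bJ2 v : D v -> bdd_meas setT D (fun p => Rintegral leb I01 (J v p)).
  move=> Dv; apply: (bdd_meas_between (a := a) (b := K + vbar)); first exact: m2.
  by move=> p Dp; exact: J2P.
have J3P v : D v ->
    a <= Rintegral G setT (fun p => Rintegral leb I01 (J v p)) <= K + surplus lam v.
  move=> Dv; apply/andP; split.
    have /andP[//] := mean_between umG (m2 v) (fun p Dp => J2P v p Dv Dp).
  (* The decision does not see [p], so a single [q], depending on [v] and the history only, serves
     all [p]. Averaging over [p] then turns [w v p] into [rfun G v - lam * cfun G v]. *)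
  have [q /andP[q0 q1] qP] :=
    randomized_choice_mean (mu := leb) (beta H v) unit_mass_lebesgue.
  have bw : bdd_meas setT D (w v).
    by apply: bdd_measD; [exact: bdd_value|apply: bdd_measZ; exact: bdd_cost].
  apply: (@le_trans _ _ (Rintegral G setT (fun p => K + q * w v p))).
    apply: (mean_le umG) => [||p Dp]; first exact: bJ2.
      by apply: bdd_measD; [exact: bdd_meas_cst|exact: bdd_measZ].
    by apply: qP; [exact: bJ|move=> g _; have /andP[] := JP v p g Dv Dp].
  rewrite (mean_D umG (bdd_meas_cst _ _ _) (bdd_measZ _ bw)) (mean_cst umG).
  rewrite (mean_Z umG _ bw).
  have -> : Rintegral G setT (w v) = rfun G v - lam * cfun G v.
    rewrite /w (mean_D umG (bdd_value Dv) (bdd_measZ _ (bdd_cost Dv))).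
    by rewrite (mean_Z umG _ (bdd_cost Dv)) mulNr.
  rewrite lerD2l /surplus; case: (leP (rfun G v - lam * cfun G v) 0) => h.
    by rewrite mulr_ge0_le0.
  by rewrite ger_pMl.
have Sv v : D v -> K + surplus lam v <= K + vbar.
  move=> Dv; have := surplus_bounds l0 Dv.
  by move: Dv; rewrite /D /= in_itv /=; lra.
have J3P' v : D v ->
    a <= Rintegral G setT (fun p => Rintegral leb I01 (J v p)) <= K + vbar.
  by move=> Dv; have /andP[-> /= /le_trans] := J3P v Dv; apply; exact: Sv.
apply/andP; split; first by have /andP[] := mean_between umF m1 J3P'.
have bs := bdd_surplus l0.
have -> : a + n.+1%:R * dd + lam * (B - spent) + lam * vbar =
    Rintegral F setT (fun v => K + surplus lam v).
  rewrite (mean_D umF (bdd_meas_cst _ _ _) bs) (mean_cst umF).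
  by rewrite -/dd /K -natr1; ring.
apply: (mean_le umF) => [||v Dv].
- exact: bdd_meas_between J3P'.
- by apply: bdd_measD => //; exact: bdd_meas_cst.
by have /andP[] := J3P v Dv.
Qed.

End Throttling.

(** The strategy that never participates gives the lower bound and shows that the supremum is over a
    nonempty set; the Lagrangian bound shows that this set is bounded above. *)
Lemma thrOpt_bounds (R : realType) (F G : probability R R) (vbar rho lam : R)
    (full : bool) (T : nat) :
  let D := [set` `[0, vbar]] in
  unit_mass F setT D -> unit_mass G setT D ->
  0 < vbar -> 0 <= rho -> 0 <= lam ->
  0 <= thrOpt full F G rho T <=
    T%:R * (Rintegral F setT (surplus G lam) + lam * rho) + lam * vbar.
Proof.
move=> D umF umG vbar0 rho0 lam0; rewrite /thrOpt.
set A := [set _ | _ in _].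
set ub := _ + lam * vbar.
have ubA : ubound A ub.
  move=> _ [beta mb <-]; have rT : 0 <= rho * T%:R by rewrite mulr_ge0.
  have E0 : thr_revT full beta rho T =
      (fun s => 0 + thr_rev full beta (rho * T%:R) [::] 0 s).
    by apply/funext => s; rewrite add0r.
  rewrite /= E0 in mb *.
  have /andP[_ /le_trans] := thr_mean_bounds umF umG vbar0 lam0 rT mb; apply.
  by rewrite /ub; lra.
have A0 : A 0.
  have E0 : thr_revT full (fun _ _ _ => false) rho T = (fun=> 0).
    apply/funext => s; rewrite /thr_revT; elim: s [::] => [//|[[v p] g] s IH] H /=.
    by rewrite addr0 mulr_ge0// IH addr0.
  exists (fun _ _ _ => false); rewrite /= E0; last exact: iidE3_cst umF umG _ _.
  exact: iidE3_measurable_cst.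
rewrite (sup_upper_bound (conj (ex_intro _ _ A0) (ex_intro _ _ ubA)))//=.
by apply: ge_sup; first by exists 0.
Qed.

(** * The gap between the two duals *)

Section DualityGap.
Variables (R : realType) (F G : probability R R) (vbar rho L : R).
Let D : set R := [set` `[0, vbar]].
Hypotheses (umF : unit_mass F setT D) (umG : unit_mass G setT D).
Hypotheses (vbar0 : 0 < vbar) (rho0 : 0 < rho) (L0 : 0 < L).
Hypothesis G_density : exists g : R -> R, measurable_fun setT g /\ (forall x, 0 <= g x) /\
     (forall x : R, 0 <= x <= vbar -> L <= g x) /\
     (forall A, measurable A ->
        G A = (\int[@lebesgue_measure R]_(x in A) (g x)%:E)%E).
Hypothesis overspend : rho < Rintegral F setT (cfun G).

Lemma density_itv (a b : R) : 0 <= a -> a <= b -> b <= vbar ->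
  L * (b - a) <= fine (G [set` `[a, b]]).
Proof.
move=> a0 ab bv; have [g [mg [g0 [gL GE]]]] := G_density.
have lE : (\int[@lebesgue_measure R]_(x in `[a, b]) L%:E = (L * (b - a))%:E)%E.
  rewrite integral_cst//= lebesgue_measure_itv /= lte_fin.
  move: ab; rewrite le_eqVlt => /predU1P[->|->]; last by [].
  by rewrite ltxx subrr mulr0 mule0.
rewrite -lee_fin fineK; last by rewrite fin_num_measure.
rewrite GE// -lE; apply: ge0_le_integral => //.
- by move=> x _; rewrite lee_fin ltW.
- by apply/measurable_EFinP; exact: measurable_funTS.
- move=> x /=; rewrite in_itv /= => /andP[ax xb]; rewrite lee_fin gL//.
  by rewrite (le_trans a0 ax) (le_trans xb bv).
Qed.

(** Markov-type bound through which the density floor [L] makes strict inequalities quantitative. *)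
Lemma mean_ge_itv (f : R -> R) (c a b : R) : bdd_meas setT D f ->
  0 <= c -> 0 <= a -> a <= b -> b <= vbar ->
  (forall x, D x -> 0 <= f x) -> (forall x, a <= x <= b -> c <= f x) ->
  c * (L * (b - a)) <= Rintegral G setT f.
Proof.
move=> bf c0 a0 ab bv f0 fc.
have bi : bdd_meas setT D (fun x => \1_([set` `[a, b]]) x : R).
  apply: (bdd_meas_between (a := 0) (b := 1)) => [|x _]; first exact: measurable_indic.
  by rewrite indicE; case: (_ \in _); rewrite /= lexx ler01.
apply: (@le_trans _ _ (Rintegral G setT (fun x => c * \1_([set` `[a, b]]) x))).
  rewrite (mean_Z umG)// ler_wpM2l// (le_trans (density_itv a0 ab bv))//.
  by rewrite /Rintegral integral_indic// setIT.
apply: (mean_le umG) => //; first exact: bdd_measZ.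
move=> x Dx; rewrite indicE; have [|_] := boolP (x \in _); last by rewrite mulr0 f0.
by rewrite inE /= in_itv /= mulr1; exact: fc.
Qed.

(* Utility of a buyer who observes [p] and is charged [mu] per unit of expense. *)
Definition paced_value (mu v p : R) : R := Num.max (v - (1 + mu) * p) 0.

Lemma measurable_paced_value mu :
  measurable_fun setT (fun x : R * R => paced_value mu x.1 x.2).
Proof.
apply: measurable_maxr => //; apply: measurable_funB => //.
exact: measurable_funM.
Qed.

Lemma paced_value_bounds mu v p : 0 <= mu -> D v -> D p -> 0 <= paced_value mu v p <= v.
Proof.
rewrite /D /paced_value /= !in_itv /= => m0 /andP[v0 v1] /andP[p0 p1].
have : 0 <= (1 + mu) * p by rewrite mulr_ge0//; lra.
by case: (leP (v - (1 + mu) * p) 0) => h; lra.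
Qed.

Lemma bdd_paced_value mu v : 0 <= mu -> D v -> bdd_meas setT D (paced_value mu v).
Proof.
move=> m0 Dv; apply: (bdd_meas_between (a := 0) (b := v)) => [|p];
    last exact: paced_value_bounds.
exact: measurableT_comp (measurable_paced_value mu) (pair1_measurable v).
Qed.

Definition mean_paced mu v := Rintegral G setT (paced_value mu v).

Lemma mean_paced_bounds mu v : 0 <= mu -> D v -> 0 <= mean_paced mu v <= v.
Proof.
move=> m0 Dv; apply: (mean_between umG) => [|p]; last exact: paced_value_bounds.
by case: (bdd_paced_value m0 Dv).
Qed.

Lemma bdd_mean_paced mu : 0 <= mu -> bdd_meas setT D (mean_paced mu).
Proof.
move=> m0; apply: (bdd_meas_between (a := 0) (b := vbar)) => [|v Dv].
  exact: measurable_Rintegral_param (measurable_paced_value mu).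
have := mean_paced_bounds m0 Dv; move: Dv; rewrite /D /= in_itv /=; lra.
Qed.

Lemma dualE mu : 0 <= mu ->
  dual F G rho mu = Rintegral F setT (mean_paced mu) + mu * rho.
Proof.
move=> m0.
have -> : Rintegral F setT (mean_paced mu) + mu * rho =
    Rintegral F setT (fun v => mean_paced mu v + mu * rho).
  by rewrite (mean_D umF (bdd_mean_paced m0) (bdd_meas_cst _ _ _)) (mean_cst umF).
have mlag : measurable_fun setT (fun x : R * R => lagrangian rho mu x.1 x.2).
  exact: measurable_lagrangian.
suff E v : D v -> Rintegral G setT (fun p => lagrangian rho mu v p) =
    mean_paced mu v + mu * rho.
  have b1 : bdd_meas setT D (fun v => mean_paced mu v + mu * rho).
    by apply: bdd_measD; [exact: bdd_mean_paced|exact: bdd_meas_cst].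
  have b2 : bdd_meas setT D (fun v => Rintegral G setT (fun p => lagrangian rho mu v p)).
    case: b1 => _ [C bC]; split; last by exists C => v Dv; rewrite E// bC.
    exact: measurable_Rintegral_param mlag.
  (* The integrands are known to agree only on [D], so equality is obtained from two
     inequalities. *)
  by rewrite /dual; apply/le_anti/andP; split; apply: (mean_le umF) => // v Dv; rewrite E.
move=> Dv; rewrite /lagrangian.
by rewrite (mean_D umG (bdd_paced_value m0 Dv) (bdd_meas_cst _ _ _)) (mean_cst umG).
Qed.

(** Prices up to half the bid, [p <= v / (2 * (1 + mu))], leave utility at least [v / 2] and have
    mass at least [L] times that half bid. *)
Lemma mean_paced_ge mu v : 0 <= mu -> D v ->
  L * v ^+ 2 <= 4 * (1 + mu) * mean_paced mu v.
Proof.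
move=> m0 Dv; have := Dv; rewrite /D /= in_itv /= => /andP[v0 v1].
have m1 : 0 < 1 + mu by lra.
pose b := v / (2 * (1 + mu)).
have b0 : 0 <= b by rewrite divr_ge0// mulr_ge0// ltW.
have bE : b * (2 * (1 + mu)) = v by rewrite /b divfK// gt_eqF// mulr_gt0.
have bv : b <= v by have := mulr_ge0 b0 m0; lra.
have /= := @mean_ge_itv (paced_value mu v) (v / 2) 0 b (bdd_paced_value m0 Dv).
have -> : L * v ^+ 2 = 4 * (1 + mu) * (v / 2 * (L * (b - 0))).
  by rewrite -[in LHS]bE -[in RHS]bE; field.
move=> h; rewrite ler_wpM2l//; first by lra.
apply: h => //; [lra|lra|by move=> p Dp; have /andP[] := paced_value_bounds m0 Dv Dp|].
move=> p /andP[p0 pb]; rewrite /paced_value le_max.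
have : (1 + mu) * p <= (1 + mu) * b by rewrite ler_wpM2l// ltW.
by move=> ?; apply/orP; left; lra.
Qed.

(** Quantitative Jensen: [paced_value] is the positive part of [w], while [surplus] is the positive
    part of the mean of [w]. If the latter is 0, the gap is [mean_paced] itself; otherwise it is the
    mean of the negative part of [w]. *)
Lemma surplus_gap mu kappa v : 0 <= mu -> D v ->
  4 * (1 + mu) * kappa <= L -> 4 * (1 + mu) * kappa <= L * mu ^+ 2 ->
  surplus G mu v + kappa * v ^+ 2 <= mean_paced mu v.
Proof.
move=> m0 Dv k1 k2; have := Dv; rewrite /D /= in_itv /= => /andP[v0 v1].
have m1 : 0 < 1 + mu by lra.
have m4 : 0 < 4 * (1 + mu) by lra.
have v2 : 0 <= v ^+ 2 := sqr_ge0 v.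
have ge1 : kappa * v ^+ 2 <= mean_paced mu v.
  rewrite -(ler_pM2l m4); apply: le_trans (mean_paced_ge m0 Dv).
  by rewrite mulrA ler_wpM2r.
pose w p := value v p + - mu * cost v p.
have bw : bdd_meas setT D w.
  by apply: bdd_measD; [exact: bdd_value|apply: bdd_measZ; exact: bdd_cost].
have mw : Rintegral G setT w = rfun G v - mu * cfun G v.
  rewrite (mean_D umG (bdd_value Dv) (bdd_measZ _ (bdd_cost Dv))).
  by rewrite (mean_Z umG _ (bdd_cost Dv)) mulNr.
have bm := bdd_paced_value m0 Dv.
have bn : bdd_meas setT D (fun p => paced_value mu v p + -1 * w p).
  by apply: bdd_measD => //; exact: bdd_measZ.
have mn : Rintegral G setT (fun p => paced_value mu v p + -1 * w p) =
    mean_paced mu v - (rfun G v - mu * cfun G v).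
  by rewrite (mean_D umG bm (bdd_measZ _ bw)) (mean_Z umG _ bw) mw mulN1r.
(* The midpoint of the bid [v / (1 + mu)] and [v]; for prices between [a] and [v] the negative part
   of [w] is at least [mu * v / 2]. *)
pose a := v * (2 + mu) / (2 * (1 + mu)).
have aE : (1 + mu) * a = v * (1 + mu / 2) by rewrite /a; field; lra.
have a0 : 0 <= a by rewrite divr_ge0 ?mulr_ge0//; lra.
have av : a <= v.
  rewrite -(ler_pM2l m1) aE mulrC ler_wpM2r//; lra.
have := @mean_ge_itv _ (mu * v / 2) a v bn.
rewrite mn => h.
have ge2 : mu * v / 2 * (L * (v - a)) <= mean_paced mu v - (rfun G v - mu * cfun G v).
  apply: h => //; first by rewrite divr_ge0// mulr_ge0.
    move=> p; rewrite /D /= in_itv /= => /andP[p0 p1]; rewrite /paced_value /w /value /cost.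
    case: (leP (v - (1 + mu) * p) 0) => h1; case: (leP (v - p) 0) => h2;
      case: (leP p v) => h3; nra.
  move=> p /andP[ap pv]; rewrite /paced_value /w /value /cost pv.
  have : (1 + mu) * a <= (1 + mu) * p by rewrite ler_wpM2l// ltW.
  rewrite aE => ?.
  by case: (leP (v - (1 + mu) * p) 0) => h1; case: (leP (v - p) 0) => h2; lra.
have ge3 : kappa * v ^+ 2 <= mu * v / 2 * (L * (v - a)).
  rewrite -(ler_pM2l m4) mulrA.
  have -> : 4 * (1 + mu) * (mu * v / 2 * (L * (v - a))) = L * mu ^+ 2 * v ^+ 2.
    have -> : 4 * (1 + mu) * (mu * v / 2 * (L * (v - a))) =
      2 * mu * v * L * ((1 + mu) * v - (1 + mu) * a) by field.
    by rewrite aE; field.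
  by rewrite ler_wpM2r.
by rewrite /surplus; case: (leP (rfun G v - mu * cfun G v) 0) => h'; lra.
Qed.

Definition thr_dual (lam : R) : R := Rintegral F setT (surplus G lam) + lam * rho.

Lemma bdd_sqr : bdd_meas setT D (fun v : R => v ^+ 2).
Proof.
apply: (bdd_meas_between (a := 0) (b := vbar ^+ 2)) => [|v].
  exact: measurable_funX.
rewrite /D /= in_itv /= => /andP[v0 v1].
by rewrite sqr_ge0 ler_sqr// nnegrE ltW.
Qed.

Lemma bdd_cfun : bdd_meas setT D (cfun G).
Proof.
apply: (bdd_meas_between (a := 0) (b := vbar)) => [|v Dv].
  exact: measurable_cfun.
have := cfun_bounds umG Dv; move: Dv; rewrite /D /= in_itv /=; lra.
Qed.

(** By $v^2\ge 2\rho v-\rho^2$, $v\ge c(v)$ and [overspend]. This gives the pointwise gap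
    [kappa * v ^+ 2] a positive mean. *)
Lemma second_moment_ge : rho ^+ 2 <= Rintegral F setT (fun v => v ^+ 2).
Proof.
have b1 : bdd_meas setT D (fun v => 2 * rho * cfun G v + - rho ^+ 2).
  by apply: bdd_measD; [exact: bdd_measZ bdd_cfun|exact: bdd_meas_cst].
apply: (@le_trans _ _ (Rintegral F setT (fun v => 2 * rho * cfun G v + - rho ^+ 2))).
  rewrite (mean_D umF (bdd_measZ _ bdd_cfun) (bdd_meas_cst _ _ _)).
  rewrite (mean_cst umF) (mean_Z umF _ bdd_cfun).
  have : 2 * rho * rho <= 2 * rho * Rintegral F setT (cfun G).
    by rewrite ler_wpM2l ?mulr_ge0// ltW.
  rewrite expr2; lra.
apply: (mean_le umF) => //; first exact: bdd_sqr.
move=> v Dv; have /andP[c0 cv] := cfun_bounds umG Dv.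
have : 2 * rho * cfun G v <= 2 * rho * v by rewrite ler_wpM2l// mulr_ge0// ltW.
have := sqr_ge0 (v - rho); rewrite sqrrB -mulr_natr; lra.
Qed.

Lemma thr_dual_gap mu kappa : 0 <= mu -> 0 <= kappa ->
  4 * (1 + mu) * kappa <= L -> 4 * (1 + mu) * kappa <= L * mu ^+ 2 ->
  thr_dual mu + kappa * rho ^+ 2 <= dual F G rho mu.
Proof.
move=> m0 k0 k1 k2; rewrite dualE// /thr_dual.
have bs := bdd_surplus umG m0.
have : Rintegral F setT (fun v => surplus G mu v + kappa * v ^+ 2) <=
    Rintegral F setT (mean_paced mu).
  apply: (mean_le umF); last by move=> v Dv; exact: surplus_gap.
    by apply: bdd_measD => //; exact: bdd_measZ bdd_sqr.
  exact: bdd_mean_paced.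
rewrite (mean_D umF bs (bdd_measZ _ bdd_sqr)) (mean_Z umF _ bdd_sqr).
have := ler_wpM2l k0 second_moment_ge; lra.
Qed.

(** Raising the multiplier from 0 to [mu] costs at most [mu * p] in utility. This carries the gap at
    0 over to small multipliers, where [surplus_gap] degenerates. *)
Lemma dual_ge_dual0 mu : 0 <= mu -> dual F G rho 0 - mu * vbar <= dual F G rho mu.
Proof.
move=> m0; rewrite !dualE// mul0r addr0.
have mr : 0 <= mu * rho by rewrite mulr_ge0// ltW.
have bm := bdd_mean_paced m0; have bm0 := bdd_mean_paced (lexx 0).
suff : Rintegral F setT (mean_paced 0) <=
    Rintegral F setT (fun v => mean_paced mu v + mu * vbar).
  rewrite (mean_D umF bm (bdd_meas_cst _ _ _)) (mean_cst umF); lra.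
apply: (mean_le umF) => //; first by apply: bdd_measD => //; exact: bdd_meas_cst.
move=> v Dv; have bp := bdd_paced_value m0 Dv.
have -> : mean_paced mu v + mu * vbar =
    Rintegral G setT (fun p => paced_value mu v p + mu * vbar).
  by rewrite (mean_D umG bp (bdd_meas_cst _ _ _)) (mean_cst umG).
apply: (mean_le umG); first exact: bdd_paced_value.
  by apply: bdd_measD => //; exact: bdd_meas_cst.
move=> p; rewrite /D /= in_itv /= => /andP[p0 p1]; rewrite /paced_value.
have : 0 <= mu * p <= mu * vbar by rewrite mulr_ge0//= ler_wpM2l.
by case: (leP (v - (1 + mu) * p) 0) => ?; case: (leP (v - (1 + 0) * p) 0) => ?; lra.
Qed.

Lemma dual0_le : dual F G rho 0 <= vbar.
Proof.
rewrite dualE// mul0r addr0; have [m _] := bdd_mean_paced (lexx 0).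
suff /andP[] : 0 <= Rintegral F setT (mean_paced 0) <= vbar by [].
apply: (mean_between umF m).
move=> v Dv; have := mean_paced_bounds (lexx 0) Dv.
by move: Dv; rewrite /D /= in_itv /=; lra.
Qed.

(** A first-order expansion at 0 with slope [rho] minus the mean of [cfun]. For [v >= 4 * lam / L]
    the bound $r(v)\ge Lv^2/4\ge\lambda v\ge\lambda c(v)$ makes the surplus drop by the full
    [lam * cfun G v]; for smaller [v] the cost is below [4 * lam / L], the error term. *)
Lemma thr_dual_decr lam : 0 < lam ->
  thr_dual lam + lam * (Rintegral F setT (cfun G) - 4 * lam / L - rho) <= thr_dual 0.
Proof.
move=> lam0; rewrite /thr_dual mul0r addr0.
have [l0 lamw] := conj L0 (ltW lam0).
have bs := bdd_surplus umG lamw; have bs0 := bdd_surplus umG (lexx 0).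
suff : Rintegral F setT (fun v => surplus G lam v + lam * (cfun G v + - (4 * lam / L)))
    <= Rintegral F setT (surplus G 0).
  have bc := bdd_measD bdd_cfun (bdd_meas_cst setT D (- (4 * lam / L))).
  rewrite (mean_D umF bs (bdd_measZ _ bc)) (mean_Z umF _ bc).
  rewrite (mean_D umF bdd_cfun (bdd_meas_cst _ _ _)) (mean_cst umF); lra.
apply: (mean_le umF) => [||v Dv] //.
  apply: bdd_measD => //; apply: bdd_measZ; apply: bdd_measD; first exact: bdd_cfun.
  exact: bdd_meas_cst.
have /andP[r0 rv] := rfun_bounds umG Dv; have /andP[c0 cv] := cfun_bounds umG Dv.
have /andP[v0 _] : 0 <= v <= vbar by move: Dv; rewrite /D /= in_itv.
have rge : L * v ^+ 2 <= 4 * rfun G v.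
  have -> : rfun G v = mean_paced 0 v.
    by apply: eq_Rintegral => p _; rewrite /paced_value addr0 mul1r.
  by have := mean_paced_ge (lexx 0) Dv; rewrite addr0 mulr1.
have [vs|vs] := leP (4 * lam / L) v.
  have : lam * v <= rfun G v.
    rewrite -(ler_pM2l (_ : 0 < 4))//; apply: le_trans rge.
    have : 4 * lam <= v * L by rewrite -ler_pdivrMr.
    move/(ler_wpM2r v0); rewrite expr2; lra.
  have : 0 <= lam * (4 * lam / L) by rewrite mulr_ge0// divr_ge0// ?mulr_ge0// ltW.
  have : lam * cfun G v <= lam * v by rewrite ler_wpM2l.
  have := mulr_ge0 lamw c0.
  rewrite /surplus mul0r subr0 (max_idPl r0).
  by case: (leP (rfun G v - lam * cfun G v) 0) => h; lra.
have : lam * (cfun G v + - (4 * lam / L)) <= 0.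
  by rewrite mulr_ge0_le0//; lra.
have := mulr_ge0 lamw c0.
rewrite /surplus mul0r subr0 (max_idPl r0).
by case: (leP (rfun G v - lam * cfun G v) 0) => h; lra.
Qed.

(** One [lam] has to serve all [mu], since the multiplier of pacing moves. The comparison with
    [vbar] is for the rounds credited [vbar] after depletion. *)
Lemma exists_dual_gap (mubar : R) : 0 <= mubar ->
  exists lam delta : R, [/\ 0 <= lam, 0 < delta, thr_dual lam + delta <= vbar &
    forall mu : R, 0 <= mu <= mubar -> thr_dual lam + delta <= dual F G rho mu].
Proof.
move=> mb0; have [l0 v0 r0 ov] := And4 L0 vbar0 rho0 overspend.
set eta := Rintegral F setT (cfun G) - rho.
have eta0 : 0 < eta by rewrite subr_gt0.
(* Chosen so that the error [4 * lam0 / L] is half of the slope [eta]. *)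
pose lam0 := eta * L / 8.
have lam00 : 0 < lam0 by rewrite divr_gt0// mulr_gt0.
pose d0 := lam0 * eta / 2.
have d00 : 0 < d0 by rewrite divr_gt0// mulr_gt0.
have gap0 : thr_dual lam0 + d0 <= dual F G rho 0.
  have := thr_dual_decr lam00; have -> : 4 * lam0 / L = eta / 2.
    by rewrite /lam0; field; rewrite gt_eqF.
  have := @thr_dual_gap 0 0 (lexx 0) (lexx 0); rewrite !mul0r !mulr0 !addr0.
  move=> /(_ (ltW l0)); rewrite expr2 !mulr0 => /(_ (lexx 0)).
  have -> : lam0 * (Rintegral F setT (cfun G) - eta / 2 - rho) = d0.
    by rewrite /d0 /eta; field.
  lra.
(* Up to [mu0] the pacing dual loses at most half of the gap [d0]. *)
pose mu0 := d0 / (2 * vbar).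
have mu00 : 0 < mu0 by rewrite divr_gt0// mulr_gt0.
have mu0v : mu0 * vbar = d0 / 2 by rewrite /mu0; field; rewrite gt_eqF.
(* Meets both requirements of [thr_dual_gap] uniformly for [mu] between [mu0] and [mubar]. *)
pose kappa := L * Num.min 1 (mu0 ^+ 2) / (4 * (1 + mubar)).
have min0 : 0 < Num.min 1 (mu0 ^+ 2) by rewrite lt_min ltr01 exprn_gt0.
have m4 : 0 < 4 * (1 + mubar) by lra.
have k0 : 0 < kappa by rewrite divr_gt0// mulr_gt0.
have kE : 4 * (1 + mubar) * kappa = L * Num.min 1 (mu0 ^+ 2).
  by rewrite mulrC divfK// gt_eqF.
have gap1 mu : mu0 <= mu <= mubar -> thr_dual mu + kappa * rho ^+ 2 <= dual F G rho mu.
  move=> /andP[mu1 mu2]; have mu_ge0 : 0 <= mu by lra.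
  have kk : 4 * (1 + mu) * kappa <= L * Num.min 1 (mu0 ^+ 2).
    by rewrite -kE; apply: ler_wpM2r; [exact: ltW|lra].
  apply: thr_dual_gap => //; first exact: ltW.
    by rewrite (le_trans kk)// ger_pMr// ge_min lexx.
  rewrite (le_trans kk)// ler_pM2l// ge_min ler_sqr ?nnegrE ?mu1 ?orbT//.
  exact: ltW.
pose A := [set dual F G rho mu | mu in [set mu | 0 <= mu <= mubar]].
have infA : has_inf A.
  split; first by exists (dual F G rho 0); exists 0 => //=; rewrite lexx.
  exists (dual F G rho 0 - mubar * vbar) => _ [mu /= /andP[m0 m1] <-].
  apply: le_trans (dual_ge_dual0 m0).
  by rewrite lerD2l lerN2 ler_wpM2r// ltW.
(* Halved because the infimum is only approached: one [delta] is spent on the near-minimiser, the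
   other remains as the gap. *)
pose delta := Num.min (d0 / 2) (kappa * rho ^+ 2) / 2.
have e0 : 0 < Num.min (d0 / 2) (kappa * rho ^+ 2).
  by rewrite lt_min divr_gt0// mulr_gt0// exprn_gt0.
have del0 : 0 < delta by rewrite divr_gt0.
have del1 : 2 * delta <= d0 / 2.
  by rewrite mulrC divfK// ge_min lexx.
have del2 : 2 * delta <= kappa * rho ^+ 2.
  by rewrite mulrC divfK// ge_min lexx orbT.
suff [lam lam_ge0 lamP] : exists2 lam, 0 <= lam & thr_dual lam + delta <= inf A.
  have le_dual mu : 0 <= mu <= mubar -> thr_dual lam + delta <= dual F G rho mu.
    move=> m; apply: (le_trans lamP); apply: (inf_lbound infA.2).
    by exists mu.
  exists lam, delta; split=> //; apply: le_trans (le_dual 0 _) dual0_le.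
  by rewrite lexx.
(* Near a minimiser [mu] of the pacing dual, [lam0] works if [mu] is small, and [lam = mu]
   otherwise. *)
have [_ [mu /= /andP[m0 m1] <-] mu_inf] := inf_adherent del0 infA.
have [mu_small|mu_large] := leP mu mu0.
  exists lam0; first exact: ltW.
  have := dual_ge_dual0 m0.
  have : mu * vbar <= mu0 * vbar by rewrite ler_wpM2r// ltW.
  lra.
exists mu => //; have := gap1 mu; rewrite (ltW mu_large) m1 => /(_ isT); lra.
Qed.

End DualityGap.

(** * Assembling the linear gap *)

Lemma unit_mass_probability (R : realType) (P : probability R R) (D : set R) :
  measurable D -> P D = 1%E -> unit_mass P setT D.
Proof.
move=> mD PD; split=> //; last exact: probability_setT.
by have := probability_setC P mD; rewrite setTD PD subee.
Qed.

Lemma pacE_ge (R : realType) (F G : probability R R)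
    (vbar rho eps mubar mu1 dlow : R) (T : nat) :
  let D := [set` `[0, vbar]] in
  unit_mass F setT D -> unit_mass G setT D ->
  0 < vbar -> 0 < rho -> rho <= vbar -> 0 < eps -> vbar / rho <= mubar ->
  0 <= mu1 <= mubar ->
  (forall mu, 0 <= mu <= mubar -> dlow <= dual F G rho mu) -> dlow <= vbar ->
  T%:R * dlow - (mubar ^+ 2 / (2 * eps) + T%:R * (eps * vbar ^+ 2 / 2) + mubar * vbar)
    <= pacE F G rho eps mubar mu1 T.
Proof.
move=> D umF umG v0 r0 rv e0 rm mu1b dlowP dlowv.
apply: (pac_mean_ge v0 r0 rm umF umG mu1b) dlowP dlowv _ => [|s sT].
  by rewrite mulr_ge0// ltW.
have B0 : 0 <= rho * T%:R by rewrite mulr_ge0// ltW.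
have [w [ww]] := dual_rev_pac_rev v0 r0 rv e0 rm mu1b B0 sT.
(* The initial budget is exactly [rho * T], so the budget term reduces to [w * vbar]. *)
rewrite subrr add0r.
set X := dual_rev _ _ _ _ _ _ _; set Y := pac_rev _ _ _ _ _ _.
have wb : 0 <= w <= mubar.
  have u0 : 0 < vbar / rho by rewrite divr_gt0.
  by case: ww => ->; [rewrite lexx; lra|rewrite rm ltW].
move=> XY; have mb0 : 0 <= mubar by lra.
have mw : (mu1 - w) ^+ 2 <= mubar ^+ 2.
  have : 0 <= (mubar - (mu1 - w)) * (mubar + (mu1 - w)) by rewrite mulr_ge0//; lra.
  lra.
have wv : w * vbar <= mubar * vbar by apply: ler_wpM2r; [exact: ltW|case/andP: wb].
have e2 : 0 < 2 * eps by rewrite mulr_gt0.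
suff : 2 * eps * (X - (mubar ^+ 2 / (2 * eps) + T%:R * (eps * vbar ^+ 2 / 2) +
    mubar * vbar)) <= 2 * eps * Y by rewrite ler_pM2l.
have -> : 2 * eps * (X - (mubar ^+ 2 / (2 * eps) + T%:R * (eps * vbar ^+ 2 / 2) +
    mubar * vbar)) = 2 * eps * X -
    (mubar ^+ 2 + T%:R * (eps * vbar) ^+ 2 + 2 * eps * (mubar * vbar)).
  by field; rewrite gt_eqF.
have : 2 * eps * (w * vbar) <= 2 * eps * (mubar * vbar) by rewrite ler_wpM2l// ltW.
lra.
Qed.

Theorem theorem8 (R : realType) (vbar rho L : R) (F G : probability R R)
    (full : bool) (eps : nat -> R) (epsL epsU mubar mu1 : R) :
  0 < vbar -> 0 < rho -> rho <= vbar ->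
  F [set` `[0, vbar]] = 1%:E -> G [set` `[0, vbar]] = 1%:E ->
  0 < L ->
  (exists g : R -> R, measurable_fun setT g /\ (forall x, 0 <= g x) /\
     (forall x, 0 <= x <= vbar -> L <= g x) /\
     (forall A, measurable A ->
        G A = (\int[@lebesgue_measure R]_(x in A) (g x)%:E)%E)) ->
  (forall lam : R, 0 < lam ->
     (0 < F [set v : R | (0 < v <= vbar)%R /\ (rfun G v / cfun G v)%R <> lam])%E) ->
  Rintegral F setT (cfun G) > rho ->
  0 < epsL -> epsL <= epsU ->
  (forall T : nat, (0 < T)%N ->
     epsL / Num.sqrt T%:R <= eps T <= epsU / Num.sqrt T%:R) ->
  vbar / rho <= mubar -> 0 <= mu1 <= mubar ->
  exists (c1 c2 : R) (T0 : nat), 0 < c1 /\ 0 < c2 /\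
    forall T : nat, (T0 <= T)%N ->
      c1 * T%:R <= pacE F G rho (eps T) mubar mu1 T - thrOpt full F G rho T
                <= c2 * T%:R.
Proof.
move=> v0 r0 rv FD GD L0 Gdens _ ov el0 elu epsP rm mu1b.
have umF := unit_mass_probability (measurable_itv _) FD.
have umG := unit_mass_probability (measurable_itv _) GD.
have mb0 : 0 <= mubar by lra.
have [lam [del [lam0 del0 gap_v gap]]] :=
  exists_dual_gap umF umG v0 r0 L0 Gdens ov mb0.
set d := thr_dual F G rho lam in gap_v gap.
have eu0 : 0 < epsU by lra.
(* For steps of order $T^{-1/2}$ the regret is at most [C1] times $\sqrt T$; [C2] collects the end
   effects of both strategies. *)
pose C1 := mubar ^+ 2 / (2 * epsL) + epsU * vbar ^+ 2 / 2.
pose C2 := mubar * vbar + lam * vbar.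
have C10 : 0 <= C1.
  by rewrite addr_ge0// divr_ge0 ?mulr_ge0 ?sqr_ge0// ltW.
have C20 : 0 <= C2 by rewrite addr_ge0// mulr_ge0// ltW.
pose M := 2 * (C1 + C2) / del.
have M0 : 0 <= M by rewrite divr_ge0 ?(ltW del0)// mulr_ge0// addr_ge0.
(* Half of the dual gap survives once $\sqrt T\ge M$; the successor also forces [T > 0]. For the
   upper bound, pacing earns at most [vbar] per round and throttling at least 0. *)
exists (del / 2), vbar, (Num.bound (M ^+ 2)).+1.
split; first by rewrite divr_gt0.
split=> // T TM; have T0 : (0 < T)%N by exact: leq_trans TM.
set s := Num.sqrt (T%:R : R).
have ss : s ^+ 2 = T%:R by rewrite sqr_sqrtr.
have s1 : 1 <= s by rewrite -[leLHS]sqrtr1 ler_sqrt// ler1n.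
have s0 : 0 < s by lra.
have sM : M <= s.
  rewrite -[leLHS]ger0_norm// -sqrtr_sqr ler_sqrt//.
  apply: (le_trans (ltW (archi_boundP (sqr_ge0 M)))).
  by rewrite ler_nat ltnW.
have /andP[eL eU] := epsP T T0; rewrite -/s in eL eU.
have e0 : 0 < eps T by apply: lt_le_trans eL; rewrite divr_gt0.
have BT : 0 <= rho * T%:R by rewrite mulr_ge0// ltW.
have /andP[thr0 thr1] := thrOpt_bounds full T umF umG v0 (ltW r0) lam0.
have pac1 := pac_mean_le (eps T) v0 r0 rm umF umG T mu1b BT.
have pac0 := pacE_ge T umF umG v0 r0 rv e0 rm mu1b gap gap_v.
have step1 : mubar ^+ 2 / (2 * eps T) <= s * (mubar ^+ 2 / (2 * epsL)).
  have -> : s * (mubar ^+ 2 / (2 * epsL)) = mubar ^+ 2 / (2 * (epsL / s)).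
    by field; rewrite !gt_eqF.
  rewrite ler_wpM2l ?sqr_ge0// lef_pV2 ?posrE ?mulr_gt0 ?invr_gt0//.
  by rewrite ler_pM2l.
have step2 : T%:R * (eps T * vbar ^+ 2 / 2) <= s * (epsU * vbar ^+ 2 / 2).
  have -> : s * (epsU * vbar ^+ 2 / 2) = s ^+ 2 * (epsU / s * vbar ^+ 2 / 2).
    by field; rewrite gt_eqF.
  rewrite ss ler_wpM2l// ler_wpM2r// ler_wpM2r// sqr_ge0//.
have step3 : (C1 + C2) * s <= del / 2 * T%:R.
  rewrite -ss expr2 mulrA ler_wpM2r ?(ltW s0)//.
  rewrite -ler_pdivrMl ?divr_gt0//.
  by apply: le_trans sM; rewrite /M invf_div; lra.
have step4 : C2 <= C2 * s by rewrite ler_peMr.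
apply/andP; split; last first.
  by rewrite /pacE; lra.
move: thr1 pac0; rewrite -/(thr_dual F G rho lam) -/d => thr1 pac0.
rewrite /C1 in step3; rewrite /C2 in step3 step4; lra.
Qed.
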